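(* Let $A$ and $B$ be finite difference stencils on a regular lattice in $\mathbb{R}^d$ with spacing $h$, with orders of accuracy $q_a$ and $q_b$ respectively. Then stencil composition of $A$ and $B$ results in a composed stencil $C=B(A)$ with order of accuracy $q_c=\min(q_a,q_b)$.
   Context: A finite difference stencil $A$ on a regular lattice in $\mathbb{R}^d$ with spacing $h>0$ is given by finitely many integer offset vectors $u_i\in\mathbb{Z}^d$ and scalar weights $a_i$. At a target point $x_0$ it acts on a function $f$ by $\sum_i a_i f(x_0+hu_i)$. The sum is expanded formally in a Taylor series about $x_0$, in multi-index notation: $f(x_0+hu_i)=\sum_{|\alpha|\ge0}h^{|\alpha|}\frac{u_i^\alpha}{\alpha!}f^{(\alpha)}(x_0)$, where $u_i^\alpha$ denotes the component-wise power and $0^0=1$. A stencil with weights $a_i\propto h^{-|p|}$ approximates the derivative $f^{(p)}(x_0)$ with order of accuracy $q$ (a positive integer) if, in the weighted sum of Taylor series, all coefficients of derivatives of order less than that of $f^{(p)}$ vanish, the coefficient of $f^{(p)}$ is $1$, all coefficients of derivatives of order greater than $|p|$ and less than $|p|+q$ vanish, and the coefficient associated with derivative order $|p|+q$ is non-zero. That is, formally $$\sum_i a_i f(x_0+hu_i)=f^{(p)}(x_0)+\sum_{|\alpha|\ge q}t_\alpha h^{|\alpha|}f^{(\alpha+p)}(x_0),$$ with the coefficient at $|\alpha|=q$ non-zero (for $d>1$: the $t_\alpha$ with $|\alpha|=q$ are not all zero). Composition: if $A$ has offsets $u_i$ and weights $a_i$ and approximates a derivative of order $p_a$, and $B$ has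 offsets $v_j$ and weights $b_j$ and approximates a derivative of order $p_b$, then $B(A)$ is the stencil $\sum_j\sum_i a_ib_j f(x_0+h(u_i+v_j))$. Its order of accuracy is understood as that of an approximation to the derivative of order $p_a+p_b$.
   Formalization: When q_a = q_b the leading errors of A and B may cancel (forward and backward differences compose to order 2), so exact order min(q_a,q_b) is proved if and only if they do not cancel in that case; accuracy to at least order min(q_a,q_b) is proved always. *)

(* Defs.v *)
From mathcomp Require Export all_boot all_order all_algebra.
From mathcomp.multinomials Require Export mpoly.

Set Implicit Arguments.
Unset Strict Implicit.
Unset Printing Implicit Defensive.

Export Order.TTheory GRing.Theory Num.Theory.
Local Open Scope ring_scope.

(* Multi-indices are the monomials 'X_{1..d}: mdeg b is |b|, and addition and
   the componentwise order are (_ + _)%MM and (_ <= _)%MM. *)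

(* A weight is a function of the lattice spacing h, so that "proportional to a
   power of h" has a meaning. Two terms may carry the same offset, as happens
   in a composition. *)
Record stencil (R : realFieldType) (d : nat) := Stencil {
  term : finType;
  offset : term -> 'rV[int]_d;
  weight : term -> R -> R
}.

Section Stencils.
Variables (R : realFieldType) (d : nat).
Implicit Types (A B : stencil R d) (p b : 'X_{1..d}) (q : nat) (h : R).

(* B(A) : f |-> \sum_j \sum_i b_j a_i f (x0 + h (v_j + u_i)). *)
Definition compose B A : stencil R d :=
  @Stencil R d (term B * term A)%type
    (fun ji => offset ji.1 + offset ji.2)
    (fun ji h => weight ji.1 h * weight ji.2 h).

(* u^b, with 0^0 = 1. *)
Definition offset_pow (u : 'rV[int]_d) b : R :=
  \prod_(k < d) (u 0 k)%:~R ^+ b k.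

(* b! *)
Definition mi_fact b : nat := \prod_(k < d) (b k)`!.

(* The coefficient of f^(b)(x0) in the formal expansion of
   \sum_i a_i f (x0 + h u_i). *)
Definition taylor_coef A h b : R :=
  \sum_(i : term A) weight i h * (h ^+ mdeg b * offset_pow (offset i) b
                                   / (mi_fact b)%:R).

Definition weights_scale A p : Prop :=
  forall i : term A, exists c : R,
    forall h, 0 < h -> weight i h = c * h ^- mdeg p.

(* The expansion is f^(p) up to terms of derivative order at least |p| + q.
   Among the derivatives of order |p|, only f^(p) occurs. *)
Definition accurate_upto A p q : Prop :=
  weights_scale A p /\
  forall h b, 0 < h -> (mdeg b < mdeg p + q)%N ->
    taylor_coef A h b = (b == p)%:R.

Definition order_of_accuracy A p q : Prop :=
  [/\ (0 < q)%N, accurate_upto A p q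
    & exists2 b, mdeg b = (mdeg p + q)%N
               & forall h, 0 < h -> taylor_coef A h b != 0].

(* Only derivatives of the form f^(a + p), with a a (nonnegative) multi-index,
   occur in the expansion. *)
Definition derivatives_above A p : Prop :=
  forall h b, 0 < h -> taylor_coef A h b != 0 -> (p <= b)%MM.

(* The coefficient of h^q in the expansion, with X^b standing for f^(b). When the
   weights are proportional to h^-|p|, f^(b) comes with a constant times
   h^(|b| - |p|), so that constant is the value of the coefficient at h = 1. *)
Definition leading_error A p q : {mpoly R[d]} :=
  \sum_(b : 'X_{1..d < (mdeg p + q).+1} | mdeg b == (mdeg p + q)%N)
    taylor_coef A 1 b *: 'X_[b].

(* The leading error of a composition B(A) of two stencils of the same order q:
   since A ~ X^pa + leading_error A and B ~ X^pb + leading_error B, the terms of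
   lowest degree in the error of the product are these two. They may cancel, as
   they do for the forward difference (f(x+h) - f(x)) / h and the backward
   difference (f(x) - f(x-h)) / h, both of order 1, whose composition is the
   central second difference, of order 2. *)
Definition composed_leading_error B A pb pa q : {mpoly R[d]} :=
  'X_[pb] * leading_error A pa q + 'X_[pa] * leading_error B pb q.

End Stencils.

(* Main.v *)
(* Taylor coefficients of a composition are convolutions of those of the
   factors, by the binomial theorem applied to (v_j + u_i)^b / b!. Writing the
   expansions as X^pa + eA and X^pb + eB, where eA and eB start in degrees
   |pa| + qa and |pb| + qb, the product is X^(pa + pb) + X^pb eA + X^pa eB + eB eA.
   Since qa and qb are positive, eB eA starts above degree
   |pa| + |pb| + min(qa, qb), so the lowest-degree error comes from
   X^pb eA + X^pa eB. Its two parts can only cancel when qa = qb. *)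
Require Import Defs.
From mathcomp Require Import ring zify.

Set Implicit Arguments.
Unset Strict Implicit.
Unset Printing Implicit Defensive.
Local Open Scope ring_scope.

(** * Multi-indices and multiplication by monomials *)

Lemma mnm_le_mdeg d (m : 'X_{1..d}) k : (m k <= mdeg m)%N.
Proof. by rewrite mdegE (bigD1 k) //= leq_addr. Qed.

Lemma lepm_mdeg d (m n : 'X_{1..d}) : (m <= n)%MM -> (mdeg m <= mdeg n)%N.
Proof. by move/submK <-; rewrite mdegD leq_addl. Qed.

Lemma mdegB_lepm d (m n : 'X_{1..d}) :
  (m <= n)%MM -> mdeg (n - m)%MM = (mdeg n - mdeg m)%N.
Proof. by move=> le_mn; rewrite -{2}(submK le_mn) mdegD addnK. Qed.

Lemma eq_mnmB d (m n b : 'X_{1..d}) :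
  (m <= b)%MM -> ((b - m)%MM == n) = (b == (n + m)%MM).
Proof.
move=> le_mb; apply/eqP/eqP => [<-|->]; first by rewrite submK.
exact: addmK.
Qed.

Lemma mcoeffXM (R : nzRingType) d (m b : 'X_{1..d}) (p : {mpoly R[d]}) :
  ('X_[m] * p)@_b = if (m <= b)%MM then p@_(b - m) else 0.
Proof.
rewrite -commr_mpolyX; case: ifP => [le_mb|nle_mb].
  by rewrite -[in LHS](submK le_mb) addmC mcoeffMX.
rewrite mcoeffM big1 // => k /eqP def_b; rewrite mcoeffX.
case: eqP => [def_m|]; last by rewrite mulr0.
by rewrite def_b def_m lem_addl in nle_mb.
Qed.

Lemma mpolyX_neq0 (R : nzRingType) d (m : 'X_{1..d}) :
  'X_[m] != 0 :> {mpoly R[d]}.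
Proof.
apply/eqP => /(congr1 (mcoeff m))/eqP.
by rewrite mcoeffX eqxx mcoeff0 oner_eq0.
Qed.

(** * The multi-index binomial theorem, divided by factorials *)

(** Division by [n!] cancels the binomial coefficients. The bound [N] is independent of [n] so that
    all coordinates, with their different exponents, can share one index type. *)
Lemma exprD_fact (R : numFieldType) (x y : R) n N : (n < N)%N ->
  (x + y) ^+ n / n`!%:R =
    \sum_(j < N | (j <= n)%N)
      (x ^+ j / j`!%:R) * (y ^+ (n - j) / (n - j)`!%:R).
Proof.
move=> lt_nN; rewrite addrC exprDn mulr_suml.
rewrite (big_ord_widen_cond N xpredT
  (fun i : nat => y ^+ (n - i) * x ^+ i *+ 'C(n, i) / n`!%:R)) //=.
apply: eq_bigr => j le_jn; rewrite ltnS in le_jn.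
have nz m : m`!%:R != 0 :> R by rewrite pnatr_eq0 -lt0n fact_gt0.
rewrite -(bin_fact le_jn) !natrM -mulr_natl.
have nzC : 'C(n, j)%:R != 0 :> R by rewrite pnatr_eq0 -lt0n bin_gt0.
by field; rewrite ?nz ?nzC.
Qed.

Lemma offset_pow_div_fact (R : realFieldType) d (u : 'rV[int]_d)
    (b : 'X_{1..d}) :
  offset_pow R u b / (mi_fact b)%:R =
    \prod_(k < d) ((u 0 k)%:~R ^+ b k / (b k)`!%:R).
Proof. by rewrite prodf_div /mi_fact natr_prod. Qed.

(** Expanding the product chooses some [j <= b k] for each [k], and such a choice is exactly a
    multi-index below [b]; its degree is at most [mdeg b], hence below [N]. *)
Lemma big_distr_mnm (R : comNzSemiRingType) d (b : 'X_{1..d}) N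
    (F : 'I_d -> nat -> R) : (mdeg b < N)%N ->
  \prod_(k < d) \sum_(j < N | (j <= b k)%N) F k j =
    \sum_(c : 'X_{1..d < N} | (c <= b)%MM) \prod_(k < d) F k (c k).
Proof.
case: N => // N lt_bN; rewrite (big_distr_big_dep ord0) /=.
pose toF (c : 'X_{1..d < N.+1}) : {ffun 'I_d -> 'I_N.+1} :=
  [ffun k => inord (c k)].
(* The default [bm0] is never reached for families bounded by [b], whose degree is below the
   bound. *)
pose ofF (f : {ffun 'I_d -> 'I_N.+1}) : 'X_{1..d < N.+1} :=
  insubd bm0 [multinom (f k : nat) | k < d].
have toFE c k : toF c k = c k :> nat.
  by rewrite ffunE inordK // (leq_ltn_trans (mnm_le_mdeg c k)) ?bmdeg.
have toFK c : ofF (toF c) = c.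
  apply/val_inj; rewrite /= val_insubd.
  have -> : [multinom (toF c k : nat) | k < d] = val c.
    by apply/mnmP=> k; rewrite mnmE toFE.
  by rewrite bmdeg.
have famP (f : {ffun 'I_d -> 'I_N.+1}) :
    reflect (forall k, f k <= b k)%N
      (f \in pfamily ord0 predT (fun k => [pred j : 'I_N.+1 | (j <= b k)%N])).
  apply: (iffP pfamilyP) => [[_ le_fb] k|le_fb]; first exact: le_fb.
  by split=> [|k _]; [apply/subsetP|apply: le_fb].
rewrite (reindex_onto toF ofF) => [|f /famP le_fb]; last first.
  apply/ffunP=> k; apply/val_inj; rewrite /= toFE /ofF val_insubd.
  set m := [multinom _ | _ < _]; have le_mb : (m <= b)%MM.
    by apply/mnm_lepP=> i; rewrite mnmE.
  by rewrite (leq_ltn_trans (lepm_mdeg le_mb)) // mnmE.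
apply: eq_big => [c|c _]; last by apply: eq_bigr => k _; rewrite toFE.
rewrite toFK eqxx andbT; apply/famP/mnm_lepP => le_cb k;
  by have := le_cb k; rewrite toFE.
Qed.

Lemma offset_powD_div_fact (R : realFieldType) d (u v : 'rV[int]_d)
    (b : 'X_{1..d}) :
  offset_pow R (u + v) b / (mi_fact b)%:R =
    \sum_(c : 'X_{1..d < (mdeg b).+1} | (c <= b)%MM)
      (offset_pow R u c / (mi_fact c)%:R) *
      (offset_pow R v (b - c)%MM / (mi_fact (b - c)%MM)%:R).
Proof.
rewrite offset_pow_div_fact.
under eq_bigr => k _ do
  rewrite mxE intrD (exprD_fact _ _ (N := (mdeg b).+1)) ?ltnS ?mnm_le_mdeg //.
rewrite (big_distr_mnm (fun k j => ((u 0 k)%:~R ^+ j / j`!%:R) *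
  ((v 0 k)%:~R ^+ (b k - j) / (b k - j)`!%:R))) //.
apply: eq_bigr => c _; rewrite !offset_pow_div_fact -big_split /=.
by apply: eq_bigr => k _; rewrite mnmBE.
Qed.

(** * Taylor coefficients of a composition *)

Lemma taylor_coef_compose (R : realFieldType) d (A B : stencil R d) h b :
  taylor_coef (compose B A) h b =
    \sum_(c : 'X_{1..d < (mdeg b).+1} | (c <= b)%MM)
      taylor_coef B h c * taylor_coef A h (b - c)%MM.
Proof.
under [RHS]eq_bigr => c _ do rewrite /taylor_coef big_distrlr /=.
rewrite exchange_big /taylor_coef -(pair_bigA _ (fun j i =>
  weight j h * weight i h * (h ^+ mdeg b * offset_pow R (offset j + offset i) b
    / (mi_fact b)%:R))) /=.
apply: eq_bigr => j _; rewrite exchange_big; apply: eq_bigr => i _ /=.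
rewrite -[_ / _]mulrA offset_powD_div_fact !mulr_sumr; apply: eq_bigr => c le_cb.
(* Since |b| = |b - c| + |c|, the power of [h] splits between the two factors. *)
rewrite -{1}(submK le_cb) mdegD exprD.
by ring.
Qed.

(** * Accuracy and scaling under composition *)

Section Accuracy.
Variables (R : realFieldType) (d : nat).
Implicit Types (A B : stencil R d) (p b : 'X_{1..d}).

Lemma weights_scale_compose A B pa pb :
  weights_scale A pa -> weights_scale B pb ->
  weights_scale (compose B A) (pa + pb)%MM.
Proof.
move=> sA sB [j i]; have [a aE] := sA i; have [c cE] := sB j.
exists (c * a) => h h_gt0 /=; rewrite aE // cE //.
by rewrite mdegD exprD invfM mulrACA [h ^- mdeg pb * _]mulrC.
Qed.

Lemma taylor_coef_scale A p h b : weights_scale A p -> 0 < h ->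
  taylor_coef A h b = h ^+ mdeg b * h ^- mdeg p * taylor_coef A 1 b.
Proof.
move=> sA h_gt0; rewrite /taylor_coef mulr_sumr; apply: eq_bigr => i _.
have [c cE] := sA i; rewrite (cE h) // (cE 1) // !expr1n invr1.
by ring.
Qed.

(** The spacing enters only through a nonzero power of [h], so nonvanishing can be tested at
    [h = 1], where [leading_error] is evaluated. *)
Lemma taylor_coef_scale_neq0 A p h b : weights_scale A p -> 0 < h ->
  (taylor_coef A h b != 0) = (taylor_coef A 1 b != 0).
Proof.
move=> sA h_gt0; rewrite (taylor_coef_scale _ sA h_gt0) !mulf_eq0 invr_eq0.
by rewrite !expf_eq0 gt_eqF // !andbF.
Qed.

(* The last term removes the product X^pb X^pa, which the first two both count. *)
Lemma taylor_coef_compose_low A B pa pb qa qb h b :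
  accurate_upto A pa qa -> accurate_upto B pb qb -> 0 < h ->
  (mdeg b < mdeg pa + mdeg pb + qa + qb)%N ->
  taylor_coef (compose B A) h b =
    (if (pb <= b)%MM then taylor_coef A h (b - pb)%MM else 0) +
    (if (pa <= b)%MM then taylor_coef B h (b - pa)%MM else 0) -
    (b == (pa + pb)%MM)%:R.
Proof.
move=> [_ accA] [_ accB] h_gt0 lt_b; rewrite taylor_coef_compose.
have pick (p : 'X_{1..d}) (F : 'X_{1..d} -> R) :
    \sum_(c : 'X_{1..d < (mdeg b).+1} | (c <= b)%MM) (val c == p)%:R * F c =
    if (p <= b)%MM then F p else 0.
  case: ifPn => [le_pb|nle_pb]; last first.
    rewrite big1 // => c le_cb; case: eqP => [def_p|_]; last by rewrite mul0r.
    by rewrite -def_p le_cb in nle_pb.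
  have lt_pb : (mdeg p < (mdeg b).+1)%N by rewrite ltnS lepm_mdeg.
  rewrite (bigD1 (BMultinom lt_pb)) //= eqxx mul1r big1 ?addr0 // => c.
  case/andP=> _ /negbTE ne_cp.
  by rewrite -[_ == p]/(c == BMultinom lt_pb) ne_cp mul0r.
(* (tB - [pb]) (tA - [pa]) = 0: one factor vanishes for degree reasons. *)
have split_term (c : 'X_{1..d < (mdeg b).+1}) : (c <= b)%MM ->
    taylor_coef B h c * taylor_coef A h (b - c)%MM =
    (val c == pb)%:R * taylor_coef A h (b - c)%MM +
    ((b - c)%MM == pa)%:R * taylor_coef B h c -
    (val c == pb)%:R * ((b - c)%MM == pa)%:R.
  move=> le_cb; have [lt_c|ge_c] := ltnP (mdeg c) (mdeg pb + qb).
    by rewrite (accB h c) //; ring.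
  rewrite (accA h (b - c)%MM) //; first by ring.
  by rewrite mdegB_lepm //; have := lepm_mdeg le_cb; lia.
rewrite (eq_bigr _ split_term) sumrB big_split /=; congr (_ + _ - _).
- exact: (pick pb (fun c => taylor_coef A h (b - c)%MM)).
- case: ifPn => [le_pa|nle_pa]; last first.
    rewrite big1 // => c le_cb; rewrite eq_mnmB //.
    case: eqP => [def_b|_]; last by rewrite mul0r.
    by rewrite def_b lem_addr in nle_pa.
  (* The condition b - c = pa is read as c = b - pa, a delta in [c] that [pick] can evaluate. *)
  have := pick (b - pa)%MM (taylor_coef B h).
  rewrite lem_subr => <-; apply: eq_bigr => c le_cb.
  by rewrite [val c == _]eq_sym !eq_mnmB // addmC.
- rewrite (pick pb (fun c => ((b - c)%MM == pa)%:R)).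
  case: ifPn => [le_pb|nle_pb]; first by rewrite eq_mnmB.
  by case: eqP => // def_b; rewrite def_b lem_addl in nle_pb.
Qed.

(** In these degrees both shifted coefficients fall where [A] and [B] are exact, so each is the
    delta at [pa + pb]; the correction term removes one of the two. *)
Lemma accurate_upto_compose A B pa pb qa qb :
  (0 < qa)%N -> (0 < qb)%N ->
  accurate_upto A pa qa -> accurate_upto B pb qb ->
  accurate_upto (compose B A) (pa + pb)%MM (minn qa qb).
Proof.
move=> qa_gt0 qb_gt0 accA accB; have [[sA tA] [sB tB]] := (accA, accB).
split=> [|h b h_gt0]; first exact: weights_scale_compose.
rewrite mdegD => lt_b; rewrite (taylor_coef_compose_low accA accB) //; last by lia.
have -> : (if (pb <= b)%MM then taylor_coef A h (b - pb)%MM else 0) =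
          (b == (pa + pb)%MM)%:R.
  case: ifPn => [le_pb|nle_pb].
    by rewrite tA ?eq_mnmB // mdegB_lepm //; have := lepm_mdeg le_pb; lia.
  by case: eqP => // def_b; rewrite def_b lem_addl in nle_pb.
have -> : (if (pa <= b)%MM then taylor_coef B h (b - pa)%MM else 0) =
          (b == (pa + pb)%MM)%:R.
  case: ifPn => [le_pa|nle_pa].
    rewrite tB ?eq_mnmB 1?addmC // mdegB_lepm //.
    by have := lepm_mdeg le_pa; lia.
  by case: eqP => // def_b; rewrite def_b lem_addr in nle_pa.
by rewrite addrK.
Qed.

(** A nonzero term of the convolution needs pb <= c and pa <= b - c, and these inequalities add
    up. *)
Lemma derivatives_above_compose A B pa pb :
  derivatives_above A pa -> derivatives_above B pb ->
  derivatives_above (compose B A) (pa + pb)%MM.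
Proof.
move=> abA abB h b h_gt0; rewrite taylor_coef_compose; apply: contraR => nle_b.
rewrite big1 // => c le_cb.
have [->|/(abB _ _ h_gt0) le_pb] := eqVneq (taylor_coef B h c) 0.
  by rewrite mul0r.
have [->|/(abA _ _ h_gt0) le_pa] := eqVneq (taylor_coef A h (b - c)%MM) 0.
  by rewrite mulr0.
case/negP: nle_b; rewrite -(submK le_cb); apply/mnm_lepP => k; rewrite !mnmDE.
by rewrite leq_add //; apply/mnm_lepP.
Qed.

(** * Leading errors as homogeneous polynomials *)

Lemma mcoeff_leading_error A p q b :
  (leading_error A p q)@_b =
    if mdeg b == (mdeg p + q)%N then taylor_coef A 1 b else 0.
Proof.
rewrite /leading_error raddf_sum /=.
under eq_bigr => c _ do rewrite mcoeffZ mcoeffX.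
case: ifPn => [deg_b|ndeg_b]; last first.
  rewrite big1 // => c deg_c; case: eqP => [def_c|_]; last by rewrite mulr0.
  by rewrite -def_c deg_c in ndeg_b.
have lt_b : (mdeg b < (mdeg p + q).+1)%N by rewrite ltnS (eqP deg_b).
rewrite (bigD1 (BMultinom lt_b)) //= eqxx mulr1 big1 ?addr0 // => c.
case/andP=> _ /negbTE ne_c.
by rewrite -[_ == b]/(c == BMultinom lt_b) ne_c mulr0.
Qed.

(** Positivity of both orders is used twice: min(qa, qb) < qa + qb puts this degree in the range of
    [taylor_coef_compose_low], and min(qa, qb) > 0 makes the delta at [pa + pb] vanish. *)
Lemma mcoeff_composed_leading_error A B pa pb qa qb b :
  (0 < qa)%N -> (0 < qb)%N ->
  accurate_upto A pa qa -> accurate_upto B pb qb ->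
  (composed_leading_error B A pb pa (minn qa qb))@_b =
    if mdeg b == (mdeg (pa + pb)%MM + minn qa qb)%N
    then taylor_coef (compose B A) 1 b else 0.
Proof.
move=> qa_gt0 qb_gt0 accA accB; rewrite mdegD mcoeffD !mcoeffXM.
rewrite !mcoeff_leading_error.
have [deg_b|ndeg_b] := eqVneq (mdeg b) (mdeg pa + mdeg pb + minn qa qb)%N.
  rewrite (taylor_coef_compose_low accA accB ltr01); last by lia.
  have -> : (b == (pa + pb)%MM) = false.
    by apply/eqP => def_b; move: deg_b; rewrite def_b mdegD; lia.
  rewrite subr0; congr (_ + _); case: ifPn => // le_pb; rewrite ifT //;
    rewrite mdegB_lepm //; have := lepm_mdeg le_pb; lia.
(* In every other degree both products have coefficient zero, by homogeneity. *)
have out (m : 'X_{1..d}) k (x : R) : mdeg b != (mdeg m + k)%N ->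
    (if (m <= b)%MM then if mdeg (b - m)%MM == k then x else 0 else 0) = 0.
  case: ifPn => // le_mb ndeg; rewrite ifN // mdegB_lepm //.
  by have := lepm_mdeg le_mb; lia.
by rewrite !out ?addr0 //; lia.
Qed.

Lemma order_of_accuracy_compose A B pa pb qa qb :
  (0 < qa)%N -> (0 < qb)%N ->
  accurate_upto A pa qa -> accurate_upto B pb qb ->
  order_of_accuracy (compose B A) (pa + pb)%MM (minn qa qb) <->
  composed_leading_error B A pb pa (minn qa qb) <> 0.
Proof.
move=> qa_gt0 qb_gt0 accA accB.
have accC := accurate_upto_compose qa_gt0 qb_gt0 accA accB.
split=> [[_ _ [b deg_b nz_b]] lead0|/eqP lead_neq0].
  have /eqP[] := nz_b 1 ltr01.
  have := mcoeff_composed_leading_error b qa_gt0 qb_gt0 accA accB.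
  by rewrite deg_b eqxx => <-; rewrite lead0 mcoeff0.
split=> //; first by rewrite leq_min qa_gt0.
(* The leading monomial has a nonzero coefficient, which forces it into the required degree. *)
exists (mlead (composed_leading_error B A pb pa (minn qa qb))).
  apply/eqP; move: lead_neq0; rewrite -mleadc_eq0; apply: contraNT => ndeg.
  by rewrite (mcoeff_composed_leading_error _ qa_gt0 qb_gt0) // ifN.
move=> h h_gt0; rewrite (taylor_coef_scale_neq0 _ accC.1 h_gt0).
move: lead_neq0; rewrite -mleadc_eq0; apply: contraNneq => coef0.
rewrite (mcoeff_composed_leading_error _ qa_gt0 qb_gt0) //.
by rewrite coef0; case: ifP.
Qed.

(** The more accurate stencil contributes nothing at the lower order: its expansion is still exact
    there, and [0 < q] rules out b = p. *)
Lemma leading_error_eq0 A p q q' : (0 < q)%N -> (q < q')%N ->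
  accurate_upto A p q' -> leading_error A p q = 0.
Proof.
move=> q_gt0 lt_q [_ tA]; apply/mpolyP => b.
rewrite mcoeff_leading_error mcoeff0; case: eqP => // deg_b.
rewrite tA ?deg_b ?ltn_add2l //; case: eqP => // def_b.
by move: deg_b; rewrite def_b; lia.
Qed.

Lemma leading_error_neq0 A p q :
  order_of_accuracy A p q -> leading_error A p q != 0.
Proof.
case=> _ _ [b deg_b nz_b]; apply: contraNneq (nz_b 1 ltr01) => lead0.
by have := mcoeff_leading_error A p q b; rewrite deg_b eqxx lead0 mcoeff0 => <-.
Qed.

(** Only the less accurate stencil contributes, with a monomial times a nonzero polynomial;
    polynomials over a field have no zero divisors. *)
Lemma composed_leading_error_neq0 A B pa pb qa qb : qa <> qb ->
  order_of_accuracy A pa qa -> order_of_accuracy B pb qb ->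
  composed_leading_error B A pb pa (minn qa qb) <> 0.
Proof.
move=> ne_q ordA ordB; have [qa_gt0 accA _] := ordA; have [qb_gt0 accB _] := ordB.
apply/eqP; rewrite /composed_leading_error.
have [lt_q|lt_q|//] := ltngtP qa qb.
  rewrite (leading_error_eq0 qa_gt0 lt_q accB) mulr0 addr0.
  by rewrite mulf_neq0 ?mpolyX_neq0 ?leading_error_neq0.
rewrite (leading_error_eq0 qb_gt0 lt_q accA) mulr0 add0r.
by rewrite mulf_neq0 ?mpolyX_neq0 ?leading_error_neq0.
Qed.

End Accuracy.

(** The second clause is an equivalence because leading errors of equal order may cancel; the
    expansion of the composition is then exact one degree further. *)
Theorem lemma2p4 (R : realFieldType) (d : nat) (A B : stencil R d)
    (pa pb : 'X_{1..d}) (qa qb : nat)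
    (hA : order_of_accuracy A pa qa) (hB : order_of_accuracy B pb qb) :
  [/\ accurate_upto (compose B A) (pa + pb)%MM (minn qa qb),
      order_of_accuracy (compose B A) (pa + pb)%MM (minn qa qb) <->
        (qa = qb -> composed_leading_error B A pb pa qa <> 0%R)
    & derivatives_above A pa -> derivatives_above B pb ->
        derivatives_above (compose B A) (pa + pb)%MM].
Proof.
have [qa_gt0 accA _] := hA; have [qb_gt0 accB _] := hB.
split; first exact: accurate_upto_compose.
  apply: iff_trans (order_of_accuracy_compose qa_gt0 qb_gt0 accA accB) _.
  have [eq_q|/eqP ne_q] := eqVneq qa qb.
    by rewrite -eq_q minnn; split=> // /(_ erefl).
  (* For distinct orders the condition holds vacuously, so nonvanishing has to be proved
     outright. *)
  by split=> // _; apply: composed_leading_error_neq0.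
exact: derivatives_above_compose.
Qed.
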